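(* The kernel of the action of $W=W(D_8)$ on the $240$ packings of $PG(3,2)$ is the centre of $W$, $Z(W)=\{1,w_0\}$. When restricted to a proper parabolic subgroup of $W$, such as $S_8$, $W(D_7)$, $W(D_6)$, or $W(D_5)$, the action is faithful.
   Context: Write $\mathbf{8}=\{1,\dots,8\}$. An $\mathbf{8}$-labelled Fano plane is a set of seven $3$-element subsets (''triples'') of $\mathbf{8}$ that are the lines of a Fano plane $PG(2,2)$ on seven of the eight labels; the unused label is its basepoint. There are $240$ of these; they index and are identified with the packings of $PG(3,2)$ (partitions of the $35$ lines into seven spreads, a spread being a partition of the $15$ points into five lines). Their set is $\Omega_{240}$. $W(D_8)$ is the group of signed permutations of $8$ objects involving evenly many sign changes, with generating set $S=\{(i,i+1):1\le i<8\}\cup\{\overline{(1,2)}\}$, where $\overline{(i,j)}$ exchanges objects $i$ and $j$ and changes the sign of each. $w_0$ is the longest element of $W(D_8)$, which changes the sign of all eight objects. A parabolic subgroup means a subgroup generated by a subset of $S$, and it is proper if it is not all of $W(D_8)$. In particular $S_8$, $W(D_7)$, $W(D_6)$, $W(D_5)$ are generated by $S\setminus\{\overline{(1,2)}\}$, $S\setminus\{(7,8)\}$, $S\setminus\{(6,7),(7,8)\}$, $S\setminus\{(5,6),(6,7),(7,8)\}$ respectively. Action. Let $V=\mathbb{F}_2^8/U$, where $\mathbb{F}_2^8$ has basis $\varepsilon_1,\dots,\varepsilon_8$ and $U$ is spanned by the all-ones vector; for $A\subseteq\mathbf{8}$ let $v_A$ be the coset of $\sum_{i\in A}\varepsilon_i$;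 let $\Lambda^-$ be the set of $v_A$ with $|A|$ odd. For $x\in\Omega_{240}$ with basepoint $l$, $\lambda^-(x)\subset\Lambda^-$ is the set consisting of $v_A$ for the seven triples $A$ of $x$ together with $v_{\{l\}}$; $\lambda^-$ is injective. $W(D_8)$ acts on $\Lambda^-$: unsigned permutations permute coordinates ($\varepsilon_k\mapsto\varepsilon_{w(k)}$) and changing the sign of object $i$ acts as adding $\varepsilon_i$. This permutes the sets $\lambda^-(x)$ and induces the action of $W(D_8)$ on $\Omega_{240}$ given by $\lambda^-(wx)=w\lambda^-(x)$. *)

(* Defs.v *)
From HB Require Import structures.
From mathcomp Require Import all_boot all_order all_algebra.
From mathcomp Require Import all_fingroup all_solvable.

Set Implicit Arguments.
Unset Strict Implicit.
Unset Printing Implicit Defensive.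

Import GRing.Theory.
Local Open Scope ring_scope.

(* The objects 1, ..., 8 are the elements of 'I_8, object i being the ordinal
   with value i - 1. *)
Definition obj (i : nat) : 'I_8 := inord i.-1.

(* The signed object (k, b) stands for +k if b = false and for -k if b = true;
   a signed permutation of the 8 objects is a permutation of the 16 signed
   objects that commutes with negation. *)
Notation sobj := ('I_8 * bool)%type.

Definition sneg (p : sobj) : sobj := (p.1, ~~ p.2).

Definition signed_perm (w : {perm sobj}) : bool :=
  [forall p, w (sneg p) == sneg (w p)].

(* w sends object k to sperm_obj w k, changing its sign iff sperm_sgn w k. *)
Definition sperm_obj (w : {perm sobj}) (k : 'I_8) : 'I_8 := (w (k, false)).1.
Definition sperm_sgn (w : {perm sobj}) (k : 'I_8) : bool := (w (k, false)).2.

Definition WD8_set : {set {perm sobj}} :=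
  [set w | signed_perm w & ~~ odd #|[set k | sperm_sgn w k]|].

Lemma natrF2_eq0 (n : nat) : (n%:R == 0 :> 'F_2) = ~~ odd n.
Proof. by rewrite -(dvdn_pcharf (pchar_Fp (isT : prime 2))) dvdn2. Qed.

Lemma natrF2_addb (b c : bool) :
  ((b (+) c)%:R : 'F_2) = b%:R + c%:R.
Proof. by case: b; case: c; apply/eqP. Qed.

Lemma signed_permE w k b : signed_perm w ->
  w (k, b) = (sperm_obj w k, b (+) sperm_sgn w k).
Proof.
move=> /forallP sw; rewrite /sperm_obj /sperm_sgn.
case: b => /=; last by case: (w _).
by have /eqP := sw (k, false); rewrite /sneg /= => ->.
Qed.

Lemma signed_perm1 : signed_perm 1%g.
Proof. by apply/forallP=> p; rewrite !perm1. Qed.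

Lemma signed_permM u w :
  signed_perm u -> signed_perm w -> signed_perm (u * w)%g.
Proof.
move=> /forallP su /forallP sw; apply/forallP=> p.
by rewrite !permM (eqP (su p)) (eqP (sw _)).
Qed.

Lemma sperm_objM u w k : signed_perm w ->
  sperm_obj (u * w)%g k = sperm_obj w (sperm_obj u k).
Proof.
move=> sw; rewrite {1}/sperm_obj permM.
by rewrite [u _]surjective_pairing signed_permE.
Qed.

Lemma sperm_sgnM u w k : signed_perm w ->
  sperm_sgn (u * w)%g k = sperm_sgn u k (+) sperm_sgn w (sperm_obj u k).
Proof.
move=> sw; rewrite {1}/sperm_sgn permM.
by rewrite [u _]surjective_pairing signed_permE.
Qed.

Lemma sperm_obj_inj w : signed_perm w -> injective (sperm_obj w).
Proof.
move=> sw k l eq_kl.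
have: w (k, sperm_sgn w k) = w (l, sperm_sgn w l).
  by rewrite !signed_permE // !addbb eq_kl.
by move/perm_inj=> [].
Qed.

Lemma sum_sperm_sgn w :
  \sum_k ((sperm_sgn w k)%:R : 'F_2) = #|[set k | sperm_sgn w k]|%:R.
Proof.
rewrite -natr_sum -sum1_card; congr (_%:R).
rewrite big_mkcond [RHS]big_mkcond /=.
by apply: eq_bigr => k _; rewrite inE; case: ifP.
Qed.

Lemma mem_WD8_set w :
  (w \in WD8_set) =
    signed_perm w && (\sum_k ((sperm_sgn w k)%:R : 'F_2) == 0).
Proof. by rewrite inE sum_sperm_sgn natrF2_eq0. Qed.

Lemma WD8_group_set : group_set WD8_set.
Proof.
apply/group_setP; split=> [|u w].
  rewrite mem_WD8_set signed_perm1 big1 // => k _.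
  by rewrite /sperm_sgn perm1.
rewrite !mem_WD8_set => /andP[su /eqP u0] /andP[sw /eqP w0].
rewrite signed_permM //=.
under eq_bigr => k _ do rewrite sperm_sgnM // natrF2_addb.
rewrite big_split /= u0 add0r.
by rewrite -(reindex_inj (sperm_obj_inj su) (P := predT)
  (F := fun k => (sperm_sgn w k)%:R)) /= w0.
Qed.

Canonical WD8 : {group {perm sobj}} := Group WD8_group_set.

Lemma WD8_signed w : w \in WD8 -> signed_perm w.
Proof. by rewrite [_ \in _]mem_WD8_set => /andP[]. Qed.

Lemma WD8_sum w : w \in WD8 -> \sum_k ((sperm_sgn w k)%:R : 'F_2) = 0.
Proof. by rewrite [_ \in _]mem_WD8_set => /andP[_ /eqP]. Qed.

(* For i != j: (i, j) and its barred version, respectively. *)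
Definition swap (i j : 'I_8) : {perm sobj} :=
  (tperm (i, false) (j, false) * tperm (i, true) (j, true))%g.
Definition swap_bar (i j : 'I_8) : {perm sobj} :=
  (tperm (i, false) (j, true) * tperm (i, true) (j, false))%g.

Definition Sgen : {set {perm sobj}} :=
  swap_bar (obj 1) (obj 2)
    |: [set swap (obj i.+1) (obj i.+2) | i : 'I_7].

Lemma sneg_inj : injective sneg.
Proof. by move=> [k b] [l c] [-> /negb_inj ->]. Qed.

(* The longest element of W(D_8) with respect to Sgen. *)
Definition w0 : {perm sobj} := perm sneg_inj.

Definition parabolic (P : {group {perm sobj}}) : Prop :=
  exists2 J : {set {perm sobj}}, J \subset Sgen & P = <<J>>%G.

Definition proper_parabolic (P : {group {perm sobj}}) : Prop :=
  parabolic P /\ P <> WD8.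

Definition par_S8 : {group {perm sobj}} :=
  <<Sgen :\ swap_bar (obj 1) (obj 2)>>%G.
Definition par_WD7 : {group {perm sobj}} :=
  <<Sgen :\ swap (obj 7) (obj 8)>>%G.
Definition par_WD6 : {group {perm sobj}} :=
  <<Sgen :\: [set swap (obj 6) (obj 7); swap (obj 7) (obj 8)]>>%G.
Definition par_WD5 : {group {perm sobj}} :=
  <<Sgen :\: [set swap (obj 5) (obj 6); swap (obj 6) (obj 7);
               swap (obj 7) (obj 8)]>>%G.

Lemma tperm_ifE (T : finType) (x y z : T) :
  tperm x y z = if z == x then y else if z == y then x else z.
Proof.
case: tpermP => [->|->|/eqP/negPf-> /eqP/negPf->] //; rewrite eqxx //.
by case: eqP.
Qed.

Lemma swapE i j k b : i != j ->
  swap i j (k, b) =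
    if k == i then (j, b) else if k == j then (i, b) else (k, b).
Proof.
move=> ne_ij; have ne_ji: j != i by rewrite eq_sym.
rewrite /swap permM !tperm_ifE.
by have [->|nki] := eqVneq k i; last have [->|nkj] := eqVneq k j; case: b;
  rewrite /= ?xpair_eqE ?eqxx ?(negPf ne_ij) ?(negPf ne_ji) ?(negPf nki)
    ?(negPf nkj) ?andbF /= ?xpair_eqE ?eqxx ?(negPf ne_ij) ?(negPf ne_ji)
    ?(negPf nki) ?(negPf nkj) ?andbF.
Qed.

Lemma swap_barE i j k b : i != j ->
  swap_bar i j (k, b) =
    if k == i then (j, ~~ b) else if k == j then (i, ~~ b) else (k, b).
Proof.
move=> ne_ij; have ne_ji: j != i by rewrite eq_sym.
rewrite /swap_bar permM !tperm_ifE.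
by have [->|nki] := eqVneq k i; last have [->|nkj] := eqVneq k j; case: b;
  rewrite /= ?xpair_eqE ?eqxx ?(negPf ne_ij) ?(negPf ne_ji) ?(negPf nki)
    ?(negPf nkj) ?andbF /= ?xpair_eqE ?eqxx ?(negPf ne_ij) ?(negPf ne_ji)
    ?(negPf nki) ?(negPf nkj) ?andbF.
Qed.

Lemma swap_WD8 i j : i != j -> swap i j \in WD8.
Proof.
move=> ne_ij; rewrite [_ \in _]mem_WD8_set; apply/andP; split.
  apply/forallP=> -[k b]; rewrite /sneg /= !swapE //.
  by do 2![case: ifP => //].
apply/eqP/big1=> k _; rewrite /sperm_sgn swapE //.
by do 2![case: ifP => //].
Qed.

Lemma swap_bar_WD8 i j : i != j -> swap_bar i j \in WD8.
Proof.
move=> ne_ij; have ne_ji: j != i by rewrite eq_sym.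
rewrite [_ \in _]mem_WD8_set; apply/andP; split.
  apply/forallP=> -[k b]; rewrite /sneg /= !swap_barE //.
  by do 2![case: ifP => //].
rewrite (bigD1 i) //= (bigD1 j) //= big1 => [|k /andP[nki nkj]].
  rewrite /sperm_sgn !swap_barE // eqxx (negPf ne_ji) eqxx.
  by rewrite addr0.
by rewrite /sperm_sgn swap_barE // (negPf nki) (negPf nkj).
Qed.

Lemma Sgen_sub_WD8 : Sgen \subset WD8.
Proof.
apply/subsetP=> w; rewrite in_setU1 => /orP[/eqP->|/imsetP[i _ ->]].
  by apply: swap_bar_WD8; rewrite -val_eqE /= !inordK.
have lt_i1 : (i.+1 < 8)%N by exact: (ltn_ord i).
by apply: swap_WD8; rewrite -val_eqE /= !inordK ?neq_ltn ?ltnSn // ltnW.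
Qed.

Definition Uones : {group 'rV['F_2]_8} := <[const_mx 1%R : 'rV['F_2]_8]>%G.

Notation VmodU := (coset_of Uones).

Definition vec (A : {set 'I_8}) : 'rV['F_2]_8 :=
  \sum_(i in A) delta_mx 0 i.

Definition vV (A : {set 'I_8}) : VmodU := coset Uones (vec A).

Definition Lambda_minus : {set VmodU} := [set vV A | A : {set 'I_8} & odd #|A|].

(* The permutation of coordinates k |-> sperm_obj w k, followed by the addition
   of a basis vector for each sign change. *)
Definition vact (v : 'rV['F_2]_8) (w : {perm sobj}) : 'rV['F_2]_8 :=
  \sum_k v 0 k *: delta_mx 0 (sperm_obj w k)
    + \sum_(k | sperm_sgn w k) delta_mx 0 (sperm_obj w k).

(* The map induced on V by vact; see vactV_coset. *)
Definition vactV (c : VmodU) (w : {perm sobj}) : VmodU :=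
  coset Uones (vact (repr c) w).

Lemma sum_delta (f : 'I_8 -> 'F_2) (g : 'I_8 -> 'I_8) k : injective g ->
  (\sum_i f i *: (delta_mx 0 (g i) : 'rV['F_2]_8)) 0 (g k) = f k.
Proof.
move=> g_inj; rewrite summxE (bigD1 k) //= !mxE !eqxx mulr1.
rewrite big1 ?addr0 // => i ne_ik; rewrite !mxE eqxx /=.
by rewrite (inj_eq g_inj) eq_sym (negPf ne_ik) mulr0.
Qed.

Lemma vactE v w k : signed_perm w ->
  vact v w 0 (sperm_obj w k) = v 0 k + (sperm_sgn w k)%:R.
Proof.
move=> sw; have inj := sperm_obj_inj sw.
rewrite /vact mxE sum_delta //; congr (_ + _).
rewrite big_mkcond /= -(sum_delta (fun i => (sperm_sgn w i)%:R) _ inj).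
congr (fun_of_matrix _ _ _); apply: eq_bigr => i _.
by case: ifP; rewrite ?scale1r ?scale0r.
Qed.

Lemma vecE (A : {set 'I_8}) k : vec A 0 k = (k \in A)%:R.
Proof.
rewrite /vec -(@sum_delta (fun i => (i \in A)%:R) id k) // big_mkcond.
congr (fun_of_matrix _ _ _); apply: eq_bigr => i _.
by case: ifP; rewrite ?scale1r ?scale0r.
Qed.

Lemma F2_cases (a : 'F_2) : a = (a == 1)%:R.
Proof. by case: a => [[|[|?]] ?] //; apply/eqP. Qed.

Lemma vec_supp (v : 'rV['F_2]_8) : v = vec [set k | v 0 k == 1].
Proof.
by apply/rowP=> k; rewrite vecE inE; exact: F2_cases.
Qed.

Lemma rowP_obj w (u v : 'rV['F_2]_8) : signed_perm w ->
  (forall k, u 0 (sperm_obj w k) = v 0 (sperm_obj w k)) -> u = v.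
Proof.
move=> sw eq_uv; apply/rowP=> j.
by rewrite -(f_invF (sperm_obj_inj sw) j) eq_uv.
Qed.

Lemma vactM v u w : signed_perm u -> signed_perm w ->
  vact v (u * w)%g = vact (vact v u) w.
Proof.
move=> su sw; have suw := signed_permM su sw.
apply: (rowP_obj suw) => k; rewrite vactE // sperm_objM // !vactE //.
by rewrite sperm_sgnM // natrF2_addb addrA.
Qed.

Lemma vact1 v : vact v 1%g = v.
Proof.
apply: (rowP_obj signed_perm1) => k; rewrite vactE ?signed_perm1 //.
by rewrite /sperm_obj /sperm_sgn perm1 addr0.
Qed.

Lemma vactD_const v (a : 'F_2) w : signed_perm w ->
  vact (const_mx a + v) w = const_mx a + vact v w.
Proof.
move=> sw; apply: (rowP_obj sw) => k.
have -> u : (const_mx a + u : 'rV['F_2]_8) 0 (sperm_obj w k)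
    = a + u 0 (sperm_obj w k) by rewrite [LHS]mxE mxE.
by rewrite !vactE // [in LHS]mxE [in LHS]mxE addrA.
Qed.

Lemma mem_U (v : 'rV['F_2]_8) :
  reflect (exists a : 'F_2, v = const_mx a) (v \in Uones).
Proof.
apply: (iffP (cycleP _ _)) => [[n ->]|[a ->]].
  exists n%:R; rewrite FinRing.zmodXgE.
  by apply/rowP=> k; rewrite mxE mulmxnE mxE.
exists (a : nat); rewrite FinRing.zmodXgE.
by apply/rowP=> k; rewrite mulmxnE !mxE natr_Zp.
Qed.

Lemma U_norm (v : 'rV['F_2]_8) : v \in 'N(Uones)%g.
Proof.
apply: (subsetP (sub_abelian_norm _ (subsetT Uones))); last by rewrite inE.
exact: FinRing.zmod_abelian.
Qed.

Lemma cosetUP (u v : 'rV['F_2]_8) :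
  reflect (exists a, u = const_mx a + v) (coset Uones u == coset Uones v).
Proof.
have P := rcoset_kercosetP (U_norm u) (U_norm v).
apply: (iffP eqP) => [/P/rcosetP[x /mem_U[a ->] ->]|[a ->]].
  by exists a; rewrite FinRing.zmodMgE.
apply/(rcoset_kercosetP (U_norm _) (U_norm v))/rcosetP.
by exists (const_mx a); [apply/mem_U; exists a | rewrite FinRing.zmodMgE].
Qed.

Lemma vactV_coset v w : signed_perm w ->
  vactV (coset Uones v) w = coset Uones (vact v w).
Proof.
move=> sw; rewrite /vactV.
have /eqP/cosetUP[a ->] := coset_reprK (coset Uones v).
by rewrite vactD_const //; apply/eqP/cosetUP; exists a.
Qed.

Lemma vactVM c u w : signed_perm u -> signed_perm w ->
  vactV c (u * w)%g = vactV (vactV c u) w.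
Proof.
by move=> su sw; rewrite -(coset_reprK c) !vactV_coset ?signed_permM // vactM.
Qed.

Lemma vactV1 c : vactV c 1%g = c.
Proof. by rewrite /vactV vact1 coset_reprK. Qed.

Lemma sum_vact v w : w \in WD8 ->
  \sum_k vact v w 0 k = \sum_k v 0 k.
Proof.
move=> Ww; have sw := WD8_signed Ww.
rewrite (reindex_inj (sperm_obj_inj sw)) /=.
under eq_bigr => k _ do rewrite vactE //.
by rewrite big_split /= WD8_sum // addr0.
Qed.

Lemma sum_vec A : \sum_k vec A 0 k = #|A|%:R :> 'F_2.
Proof.
rewrite -sum1_card natr_sum big_mkcond [RHS]big_mkcond /=.
by apply: eq_bigr => k _; rewrite vecE; case: ifP.
Qed.

Lemma natrF2_eq1 (n : nat) : (n%:R == 1 :> 'F_2) = odd n.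
Proof.
rewrite -[odd n]negbK -natrF2_eq0.
by move: (n%:R : 'F_2) => [[|[|m]] lt_m].
Qed.

Lemma Lambda_minusP v :
  (coset Uones v \in Lambda_minus) = (\sum_k v 0 k == 1).
Proof.
apply/imsetP/eqP=> [[A]|v1].
  rewrite inE => oA /eqP/cosetUP[a ->].
  under eq_bigr do rewrite mxE.
  rewrite big_split /= sum_vec; have /eqP-> := etrans (natrF2_eq1 _) oA.
  under eq_bigr do rewrite mxE.
  rewrite sumr_const card_ord -mulr_natr (_ : 8%:R = 0) ?mulr0 ?add0r //.
  exact/eqP.
exists [set k | v 0 k == 1]; last by rewrite /vV -vec_supp.
by rewrite inE -natrF2_eq1 -sum_vec -vec_supp v1.
Qed.

Lemma vactV_Lambda_minus c w : w \in WD8 ->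
  c \in Lambda_minus -> vactV c w \in Lambda_minus.
Proof.
move=> Ww; rewrite -(coset_reprK c) vactV_coset ?WD8_signed //.
by rewrite !Lambda_minusP sum_vact.
Qed.

(* PG(2,2): the points are the nonzero vectors of F_2^3 and the lines are the
   2-dimensional subspaces without their zero vector. *)
Definition pg_points : {set 'rV['F_2]_3} := [set p | p != 0].
Definition pg_lines : {set {set 'rV['F_2]_3}} :=
  [set [set p; q; p + q] | p in pg_points, q in pg_points & p != q].

Definition is_labelled_fano (x : {set {set 'I_8}}) : bool :=
  [exists f : {ffun 'rV['F_2]_3 -> 'I_8},
    dinjectiveb f pg_points
    && (x == [set f @: (L : {set 'rV['F_2]_3}) | L in pg_lines])].

Definition Omega240 := {x : {set {set 'I_8}} | is_labelled_fano x}.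

(* The default value is never used: see basepointP. *)
Definition basepoint (x : Omega240) : 'I_8 :=
  odflt ord0 [pick l in ~: cover (val x)].

Definition lambda_minus (x : Omega240) : {set VmodU} :=
  [set vV A | A in [set basepoint x] |: val x].

Section LambdaOfBijection.

Variables (F : 'rV['F_2]_3 -> 'I_8) (Fi : 'I_8 -> 'rV['F_2]_3).
Hypotheses (FK : cancel F Fi) (FiK : cancel Fi F).

Definition fano_of : {set {set 'I_8}} :=
  [set F @: (L : {set 'rV['F_2]_3}) | L in pg_lines].

Definition affine_of : {set 'rV['F_2]_8} :=
  [set v : 'rV['F_2]_8 | (\sum_k v 0 k == 1) && (\sum_k v 0 k *: Fi k == 0)].

Lemma F2_addrr (a : 'F_2) : a + a = 0.
Proof. by rewrite (F2_cases a) -natrF2_addb addbb. Qed.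

Lemma addrr_F2 n (p : 'rV['F_2]_n) : p + p = 0.
Proof. by apply/rowP=> i; rewrite !mxE F2_addrr. Qed.

Lemma sum_rV3 : \sum_(p : 'rV['F_2]_3) p = 0.
Proof.
apply/rowP=> i; rewrite summxE mxE.
have [j ne_ij] : exists j : 'I_3, i != j.
  by case: (eqVneq i 0) => [->|?]; [exists 1 | exists 0].
rewrite (bigID (fun p : 'rV['F_2]_3 => p 0 j == 0)) /=.
rewrite [X in _ + X](reindex_inj (addIr (delta_mx 0 j))) /=.
rewrite [X in _ + X](eq_big (fun p : 'rV['F_2]_3 => p 0 j == 0)
  (fun p => p 0 i)) ?F2_addrr // => p.
  by rewrite !mxE !eqxx; case: (p 0 j) => [[|[|m]] lt_m].
by rewrite !mxE eqxx (negPf ne_ij) addr0.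
Qed.

Lemma sum_Fi : \sum_k Fi k = 0.
Proof.
have F_inj := can_inj FK.
have bF : bijective F by exists Fi.
rewrite (reindex F) /=; last exact: onW_bij.
by under eq_bigr do rewrite FK; exact: sum_rV3.
Qed.

Lemma pg_linesP (L : {set 'rV['F_2]_3}) :
  reflect (exists p q, [/\ p != 0, q != 0, p != q & L = [set p; q; p + q]])
    (L \in pg_lines).
Proof.
apply: (iffP imset2P) => [[p q]|[p [q [p0 q0 npq ->]]]].
  by rewrite !inE => p0 /andP[q0 npq] ->; exists p, q.
by exists p q; rewrite ?inE ?p0 ?q0.
Qed.

Lemma addr_eq0_F2 (p q : 'rV['F_2]_3) : (p + q == 0) = (p == q).
Proof. by rewrite addr_eq0 -[- q]add0r -(addrr_F2 q) addrK. Qed.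

Lemma cover_fano_of : cover fano_of = [set~ F 0].
Proof.
have F_inj := can_inj FK.
apply/setP=> k; rewrite !inE -[k]FiK (inj_eq F_inj); move: (Fi k) => p.
apply/bigcupP/idP=> [[A /imsetP[L /pg_linesP[q [r [q0 r0 nqr ->]]] ->]]|p0].
  case/imsetP=> s s_in /F_inj->.
  by move: s_in; rewrite !inE -orbA => /or3P[] /eqP->; rewrite // addr_eq0_F2.
have [q /andP[q0 npq]] : exists q : 'rV['F_2]_3, (q != 0) && (p != q).
  case: (eqVneq p (delta_mx 0 0)) => [->|np].
    exists (delta_mx 0 1); apply/andP; split; apply/eqP=> /rowP/(_ 1).
      by rewrite !mxE.
    by rewrite !mxE.
  exists (delta_mx 0 0); rewrite np andbT; apply/eqP=> /rowP/(_ 0).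
  by rewrite !mxE.
exists (F @: [set p; q; p + q]); last by rewrite imset_f // !inE eqxx.
by rewrite imset_f //; apply/pg_linesP; exists p, q.
Qed.

Lemma sum_vec_Fi (A : {set 'I_8}) :
  \sum_k vec A 0 k *: Fi k = \sum_(k in A) Fi k.
Proof.
rewrite [RHS]big_mkcond; apply: eq_bigr => k _.
by rewrite vecE; case: ifP; rewrite ?scale1r ?scale0r.
Qed.

Lemma vec_affine_of (A : {set 'I_8}) :
  (vec A \in affine_of) = odd #|A| && (\sum_(k in A) Fi k == 0).
Proof. by rewrite inE sum_vec natrF2_eq1 sum_vec_Fi. Qed.

Lemma affine_small (A : {set 'I_8}) : (#|A| < 5)%N ->
  (vec A \in affine_of) = (A \in [set F 0] |: fano_of).
Proof.
have F_inj := can_inj FK; have Fi_inj := can_inj FiK.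
move=> ltA; rewrite vec_affine_of; apply/andP/idP=> [[oA /eqP sA]|].
  have /orP[/cards1P[k Ek]|A3] : (#|A| == 1%N) || (#|A| == 3%N).
    by case: #|A| ltA oA => [|[|[|[|[|]]]]].
    by move: sA; rewrite Ek big_set1 => k0; rewrite !inE -[k]FiK k0 eqxx.
  have [k Ak] : exists k, k \in A by apply/card_gt0P; rewrite (eqP A3).
  have : #|A :\ k| == 2%N by move: A3; rewrite (cardsD1 k) Ak.
  case/cards2P=> [i [j [nij Dij]]].
  have /setD1P[nik Ai] : i \in A :\ k by rewrite Dij !inE eqxx.
  have /setD1P[njk Aj] : j \in A :\ k by rewrite Dij !inE eqxx orbT.
  have EA : A = k |: [set i; j] by rewrite -Dij setD1K.
  move: sA; rewrite (big_setD1 k) //= Dij big_setU1 ?inE //= big_set1.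
  move/eqP; rewrite addr_eq0_F2 => /eqP Ek.
  apply/orP; right; apply/imsetP.
  exists [set Fi i; Fi j; Fi i + Fi j].
    apply/pg_linesP; exists (Fi i), (Fi j); split=> //.
    - apply: contraNneq njk => i0; apply/eqP/Fi_inj.
      by rewrite Ek i0 add0r.
    - apply: contraNneq nik => j0; apply/eqP/Fi_inj.
      by rewrite Ek j0 addr0.
    - by rewrite (inj_eq Fi_inj).
  by rewrite -Ek !(imsetU, imset_set1) !FiK EA setUC.
rewrite in_setU1 => /orP[/eqP->|/imsetP[L /pg_linesP[p [q [p0 q0 npq ->]]] ->]].
  by rewrite cards1 big_set1 FK eqxx.
have npr : p + q \notin [set p; q].
  by rewrite !inE -{2}[p]addr0 -{3}[q]add0r (inj_eq (addrI p))
    (inj_eq (addIr q)) (negPf p0) (negPf q0).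
rewrite card_imset // big_imset /=; last by move=> ? ? _ _ /F_inj.
rewrite [_ :|: [set p + q]]setUC cardsU1 npr cards2 npq; split=> //.
rewrite big_setU1 //= big_setU1 ?inE //= big_set1 !FK.
by rewrite addrr_F2.
Qed.

Lemma affine_shift (a : 'F_2) (v : 'rV['F_2]_8) :
  (const_mx a + v \in affine_of) = (v \in affine_of).
Proof.
rewrite !inE; congr (_ && _).
  under eq_bigr do rewrite !mxE.
  rewrite big_split /= sumr_const card_ord -mulr_natr (_ : 8%:R = 0).
    by rewrite mulr0 add0r.
  exact/eqP.
under eq_bigr do rewrite !mxE scalerDl.
by rewrite big_split /= -scaler_sumr sum_Fi scaler0 add0r.
Qed.

Lemma vV_affine (x : {set VmodU}) : 
  x = [set vV A | A in [set F 0] |: fano_of] ->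
  forall v, (coset Uones v \in x) = (v \in affine_of).
Proof.
move=> -> v; apply/imsetP/idP=> [[A xA /eqP/cosetUP[a ->]]|av].
  rewrite affine_shift affine_small //.
  move: xA; rewrite in_setU1 => /orP[/eqP->|/imsetP[L]].
    by rewrite cards1.
  case/pg_linesP=> p [q [_ _ _ ->]] ->.
  apply: leq_ltn_trans (leq_imset_card _ _) _.
  by rewrite (leq_ltn_trans (leq_card_setU _ _)) // cards1 cards2; case: eqP.
pose A := [set k | v 0 k == 1]; have Ev : v = vec A := vec_supp v.
have [ltA|leA] := ltnP #|A| 5.
  by exists A; rewrite -?affine_small // /vV -Ev.
have EC : v = const_mx 1 + vec (~: A).
  apply/rowP=> k; rewrite {1}Ev [RHS]mxE mxE !vecE in_setC.
  by case: (k \in A); apply/eqP.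
have ltC : (#|~: A| < 5)%N.
  rewrite -(ltn_add2l #|A|) cardsC card_ord.
  by rewrite (@leq_trans (5 + 5)) // leq_add2r.
exists (~: A); first by rewrite -affine_small // -(affine_shift 1) -EC.
by apply/eqP/cosetUP; exists 1.
Qed.

End LambdaOfBijection.

Lemma omegaP (x : Omega240) :
  exists (F : 'rV['F_2]_3 -> 'I_8) (Fi : 'I_8 -> 'rV['F_2]_3),
    [/\ cancel F Fi, cancel Fi F & val x = fano_of F].
Proof.
have /existsP[f /andP[/dinjectiveP f_inj /eqP Ex]] := valP x.
have c8 : #|{: 'rV['F_2]_3}| = 8%N by rewrite card_mx card_Fp.
have [l nfl] : exists l, l \notin f @: pg_points.
  have : (0 < #|~: (f @: pg_points)|)%N.
    rewrite cardsCs setCK card_ord subn_gt0.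
    apply: leq_ltn_trans (leq_imset_card _ _) _.
    have := cardsD1 (0 : 'rV['F_2]_3) [set: 'rV['F_2]_3].
    rewrite cardsT c8 inE => -[E7]; rewrite E7 ltnS leq_eqVlt; apply/orP; left.
    by apply/eqP/eq_card=> p; rewrite !inE andbT.
  by case/card_gt0P=> l; rewrite inE; exists l.
pose F (p : 'rV['F_2]_3) := if p == 0 then l else f p.
have fNl p : p != 0 -> f p != l.
  by move=> p0; apply: contraNneq nfl => <-; rewrite imset_f ?inE.
have F_inj : injective F.
  move=> p q; rewrite /F; case: (eqVneq p 0) => [->|p0].
    by case: (eqVneq q 0) => // q0 El; have := fNl _ q0; rewrite El eqxx.
  case: (eqVneq q 0) => [->|q0] E; first by have := fNl _ p0; rewrite E eqxx.
  by apply: f_inj; rewrite ?inE.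
have [|Fi FK FiK] := inj_card_bij F_inj; first by rewrite c8 card_ord.
exists F, Fi; split=> //; rewrite Ex; apply: eq_in_imset => L.
case/pg_linesP=> p [q [p0 q0 npq ->]]; apply: eq_in_imset => r.
rewrite /F; case: (eqVneq r 0) => [->|//]; rewrite !inE -orbA.
by rewrite ![0 == _]eq_sym (negPf p0) (negPf q0) addr_eq0_F2 (negPf npq).
Qed.

Lemma fano_of_labelled F Fi : cancel F Fi -> is_labelled_fano (fano_of F).
Proof.
move=> FK; apply/existsP; exists (finfun F); apply/andP; split.
  by apply/dinjectiveP=> p q _ _; rewrite !ffunE; apply: can_inj FK _ _.
apply/eqP/eq_imset=> L; apply: eq_imset => p.
by rewrite ffunE.
Qed.

Lemma basepointP (x : Omega240) : ~: cover (val x) = [set basepoint x].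
Proof.
have [F [Fi [FK FiK Ex]]] := omegaP x.
rewrite /basepoint Ex (cover_fano_of FK FiK) setCK.
by case: pickP => [l /set1P-> //|/(_ (F 0))]; rewrite inE eqxx.
Qed.

Lemma lambda_affine (x : Omega240) F Fi : cancel F Fi -> cancel Fi F ->
  val x = fano_of F ->
  forall v, (coset Uones v \in lambda_minus x) = (v \in affine_of Fi).
Proof.
move=> FK FiK Ex; apply: (vV_affine FK FiK).
rewrite /lambda_minus -basepointP Ex (cover_fano_of FK FiK) setCK.
by [].
Qed.

Lemma lambda_minus_sub x : lambda_minus x \subset Lambda_minus.
Proof.
have [F [Fi [FK FiK Ex]]] := omegaP x.
apply/subsetP=> c; rewrite -(coset_reprK c) (lambda_affine FK FiK Ex).
by rewrite inE Lambda_minusP => /andP[].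
Qed.

Lemma fano_card3 (x : Omega240) A : A \in val x -> #|A| = 3%N.
Proof.
have [F [Fi [FK FiK ->]]] := omegaP x.
case/imsetP=> L /pg_linesP[p [q [p0 q0 npq ->]]] ->.
have npr : p + q \notin [set p; q].
  by rewrite !inE -{2}[p]addr0 -{3}[q]add0r (inj_eq (addrI p))
    (inj_eq (addIr q)) (negPf p0) (negPf q0).
rewrite card_imset; last exact: can_inj FK.
by rewrite [_ :|: [set p + q]]setUC cardsU1 npr cards2 npq.
Qed.

Lemma lambda_minus_inj : injective lambda_minus.
Proof.
move=> x y Exy; apply/val_inj/setP=> A.
suff sub z t : lambda_minus z = lambda_minus t -> A \in val z -> A \in val t.
  by apply/idP/idP; apply: sub.
move=> Ezt Az; have A3 := fano_card3 Az.
have: vV A \in lambda_minus z by apply: imset_f; rewrite in_setU1 Az orbT.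
rewrite Ezt.
have [F [Fi [FK FiK Et]]] := omegaP t.
rewrite (lambda_affine FK FiK Et) (affine_small FK FiK) ?A3 //.
rewrite in_setU1 Et => /orP[/eqP EA|//].
by move: A3; rewrite EA cards1.
Qed.

Lemma lambda_minus_stable (x : Omega240) w : w \in WD8 ->
  exists y, lambda_minus y = [set vactV c w | c in lambda_minus x].
Proof.
move=> Ww; have sw := WD8_signed Ww; have Ww' := groupVr Ww.
have sw' := WD8_signed Ww'.
have [F [Fi [FK FiK Ex]]] := omegaP x.
pose t := \sum_k (sperm_sgn w k)%:R *: Fi k.
have pi_inj := sperm_obj_inj sw.
pose G p := sperm_obj w (F (p + t)).
pose Gi j := Fi (invF pi_inj j) + t.
have tK p : p + t + t = p by rewrite -addrA addrr_F2 addr0.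
have GK : cancel G Gi by move=> p; rewrite /G /Gi invF_f FK tK.
have GiK : cancel Gi G by move=> j; rewrite /G /Gi tK FiK f_invF.
have aff v : (vact v w \in affine_of Gi) = (v \in affine_of Fi).
  rewrite !inE sum_vact //; case: eqP => //= v1; congr (_ == 0).
  rewrite (reindex_inj pi_inj) /=.
  under eq_bigr => k _ do
    rewrite vactE // /Gi invF_f scalerDl !scalerDr.
  rewrite !big_split /= -!scaler_suml v1 WD8_sum // scale0r scale1r addr0.
  by rewrite -/t -addrA addrr_F2 addr0.
pose y : Omega240 := exist _ (fano_of G) (fano_of_labelled GK).
have Ey : val y = fano_of G by [].
exists y.
apply/setP=> c; rewrite -(coset_reprK c); move: (repr c) => v.
apply/idP/imsetP=> [|[d]].
  rewrite (lambda_affine GK GiK Ey) => av.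
  exists (coset Uones (vact v w^-1%g)).
    rewrite (lambda_affine FK FiK Ex) -aff -vactM // mulVg vact1 //.
  by rewrite vactV_coset // -vactM // mulVg vact1.
rewrite -(coset_reprK d) (lambda_affine FK FiK Ex) vactV_coset // => ad ->.
by rewrite (lambda_affine GK GiK Ey) aff.
Qed.

(* For w in WD8, omega_act x w is the unique y such that
   lambda_minus y = w (lambda_minus x): see lambda_omega_act and
   lambda_minus_inj. Products in {perm _} compose from left to right, so that
   the left action w x is the right action omega_act x w. *)
Definition omega_act (x : Omega240) (w : {perm sobj}) : Omega240 :=
  if w \in WD8 then
    odflt x
      [pick y | lambda_minus y == [set vactV c w | c in lambda_minus x]]
  else x.

Lemma lambda_omega_act x w : w \in WD8 ->
  lambda_minus (omega_act x w) = [set vactV c w | c in lambda_minus x].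
Proof.
move=> Ww; rewrite /omega_act Ww; case: pickP => [y /eqP //|none].
by have [y /eqP] := lambda_minus_stable x Ww; rewrite none.
Qed.

Lemma omega_act_is_action : is_action WD8 omega_act.
Proof.
have actM x : {in WD8 &, act_morph omega_act x}.
  move=> u w Wu Ww; apply: lambda_minus_inj.
  rewrite !lambda_omega_act ?groupM // -[in RHS]imset_comp.
  apply: eq_imset => c /=.
  by rewrite vactVM ?WD8_signed.
split=> // w x y; case Ww: (w \in WD8); last by rewrite /omega_act Ww.
have K z : omega_act (omega_act z w) w^-1%g = z.
  rewrite -actM ?groupV // mulgV; apply: lambda_minus_inj.
  rewrite lambda_omega_act ?group1 // -[RHS]imset_id.
  by apply: eq_imset => c; exact: vactV1.
by move=> Exy; rewrite -(K x) -(K y) Exy.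
Qed.

Canonical omega_action : action WD8 Omega240 := Action omega_act_is_action.

(* Main.v *)
Require Import Defs.
From mathcomp Require Import all_boot all_order all_algebra all_fingroup all_solvable.

Set Implicit Arguments.
Unset Strict Implicit.
Unset Printing Implicit Defensive.

Import GRing.Theory.

Local Open Scope group_scope.

(** Changing all eight signs adds the all-ones vector, which is zero in
V = F_2^8 / U; hence w0 fixes every packing. Conversely, let w act trivially
and let k be a label. The sets lambda_minus x, for x with basepoint k, have
only the class of the basis vector e_k in common
([affine_of_all_basepoint]): they are the zero sets of sum_j u_j Fi_j among
the vectors u of odd weight, Fi running over the bijections from the labels
to F_2^3 that send k to 0, and such a relation for Fi together with the one
for Fi composed with a transposition (i j) avoiding k forces u_i = u_j. So w
fixes the class of each e_k. As w acts on V by an affine map whose linear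
part permutes the coordinates by pi = sperm_obj w, the linear part fixes each
e_k + e_l modulo U; since 2 <> 8 - 2, the permutation pi preserves every
2-subset of the labels, so pi = 1. The translation part of w is then zero in
V, that is, the signs of w are all equal, and w is 1 or w0
([fix_all_packings], [kernel_WD8]). Commutation with the elements (i, j)
shows that the centre is also {1, w0} ([center_WD8]).

It follows that a subgroup P acts faithfully as soon as w0 is not in P. Since
Sgen generates W(D_8) ([gen_Sgen]), a proper parabolic subgroup is generated
by a set that misses some s in Sgen. The generators other than s fix the
fundamental weight of s, whose nonzero coordinates form a set of signed
objects containing no pair of opposites ([weight_stable]); w0 negates this
set, so w0 is not in P ([w0_notin_gen]). *)

(** * The element w0 and the centre *)

Lemma sum_sgn_w0 : (\sum_k ((sperm_sgn w0 k)%:R : 'F_2) = 0)%R.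
Proof.
under eq_bigr => k _ do rewrite /sperm_sgn permE /=.
by rewrite sumr_const card_ord; apply/eqP.
Qed.

Lemma w0_signed : signed_perm w0.
Proof. by apply/forallP=> p; rewrite !permE. Qed.

Lemma w0_WD8 : w0 \in WD8.
Proof. by rewrite [_ \in _]mem_WD8_set w0_signed sum_sgn_w0 eqxx. Qed.

Lemma vact_w0 v : vact v w0 = (const_mx 1 + v)%R.
Proof.
apply: (rowP_obj w0_signed) => k.
rewrite vactE ?w0_signed // !mxE /sperm_obj /sperm_sgn permE /=.
by rewrite addrC.
Qed.

Lemma omega_act_w0 x : omega_act x w0 = x.
Proof.
apply: lambda_minus_inj; rewrite lambda_omega_act ?w0_WD8 // -[RHS]imset_id.
apply: eq_imset => c; rewrite -(coset_reprK c) vactV_coset ?w0_signed //.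
by apply/eqP/cosetUP; exists 1%R; rewrite vact_w0.
Qed.

Lemma signed_id_sgn_const w (a : bool) : signed_perm w ->
  (forall k, sperm_obj w k = k) -> (forall k, sperm_sgn w k = a) ->
  w \in [set 1; w0].
Proof.
move=> sw obj_w sgn_w; rewrite !inE.
case: a sgn_w => sgn_w; apply/orP; [right | left]; apply/eqP/permP=> -[k b].
  by rewrite signed_permE // obj_w sgn_w permE addbT.
by rewrite signed_permE // obj_w sgn_w perm1 addbF.
Qed.

(** Most arguments below need a label away from the few labels under
discussion. *)
Lemma ord8_avoid (s : seq 'I_8) : (size s < 8)%N -> exists k, k \notin s.
Proof.
move=> lt_s; have : (0 < #|[predC s]|)%N.
  rewrite -(ltn_add2l #|s|) cardC card_ord addn0.
  exact: leq_ltn_trans (card_size s) lt_s.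
by case/card_gt0P=> k; exists k.
Qed.

(** If z is central and moves k, then the swap of k with a label j outside
{k, z k} fixes z k, so that z j = z k. Once z fixes all labels, commuting with
the swap of k and l forces the signs at k and l to agree. *)
Lemma center_WD8 : 'Z(WD8) = [set 1; w0].
Proof.
apply/eqP; rewrite eqEsubset; apply/andP; split; apply/subsetP=> w.
  case/centerP=> Ww cw; have sw := WD8_signed Ww.
  have comm i j k : i != j ->
      w (swap i j (k, false)) = swap i j (w (k, false)).
    by move=> ne_ij; rewrite -!permM cw // swap_WD8.
  have obj_w k : sperm_obj w k = k.
    apply/eqP; apply: contraTT isT => nk.
    have [j] := @ord8_avoid [:: k; sperm_obj w k] isT.
    rewrite !inE negb_or => /andP[njk njwk].
    have ne_kj : k != j by rewrite eq_sym.
    have := comm k j k ne_kj.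
    rewrite swapE // eqxx !(signed_permE _ _ sw) swapE // (negPf nk).
    rewrite eq_sym (negPf njwk) => -[/(sperm_obj_inj sw) Ejk _].
    by rewrite Ejk eqxx in njk.
  apply: (@signed_id_sgn_const w (sperm_sgn w ord0)) => // k.
  have [->//|nk] := eqVneq k ord0.
  have := comm k ord0 k nk; rewrite swapE // eqxx !(signed_permE _ _ sw) swapE //.
  by rewrite !obj_w eqxx /= => -[].
case/set2P=> ->; first exact: group1.
apply/centerP; split=> [|u Wu]; first exact: w0_WD8.
have /forallP su := WD8_signed Wu.
by apply/permP=> p; rewrite !permM !permE; apply/eqP.
Qed.

(** * The kernel of the action *)

(** Translating any bijection from the labels to F_2^3 puts a given label at
the origin, that is, makes it the basepoint. *)
Lemma labelling_at k :
  exists (F : 'rV['F_2]_3 -> 'I_8) (Fi : 'I_8 -> 'rV['F_2]_3),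
  [/\ cancel F Fi, cancel Fi F & Fi k = 0%R].
Proof.
have c8 : #|{: 'rV['F_2]_3}| = 8%N by rewrite card_mx card_Fp.
pose F p : 'I_8 := cast_ord c8 (enum_rank p).
pose Fi (j : 'I_8) : 'rV['F_2]_3 := enum_val (cast_ord (esym c8) j).
have FK : cancel F Fi by move=> p; rewrite /F /Fi cast_ordK enum_rankK.
have FiK : cancel Fi F by move=> j; rewrite /F /Fi enum_valK cast_ordKV.
exists (fun p => F (p + Fi k)%R), (fun j => (Fi j + Fi k)%R).
split=> [p | j |]; last exact: addrr_F2.
  by rewrite FK -addrA addrr_F2 addr0.
by rewrite -addrA addrr_F2 addr0.
Qed.

(** The intersection of the sets lambda_minus x over the packings x with
basepoint k is the class of e_k alone: swapping two labels i and j other than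
k in a Fano plane leads to another one with basepoint k, and the difference of
the two linear relations on u is (u_i + u_j)(Fi i + Fi j) = 0. *)
Lemma affine_of_all_basepoint (u : 'rV['F_2]_8) k :
  (forall F Fi, cancel F Fi -> cancel Fi F -> Fi k = 0%R -> u \in affine_of Fi) ->
  exists a : 'F_2, u = (const_mx a + delta_mx 0 k)%R.
Proof.
move=> uA; have [F [Fi [FK FiK Fk]]] := labelling_at k.
have [/eqP sum_u /eqP Fi_u] : (\sum_j u 0 j == 1)%R /\ (\sum_j u 0 j *: Fi j == 0)%R.
  by apply/andP; have := uA _ _ FK FiK Fk; rewrite inE.
have const i j : i != k -> j != k -> u 0%R i = u 0%R j.
  move=> nik njk; have [->//|nij] := eqVneq i j.
  pose t := tperm i j.
  have Fi_tu : (\sum_m u 0 m *: Fi (t m) = 0)%R.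
    have tK : cancel (fun p => t (F p)) (fun m => Fi (t m)).
      by move=> p; rewrite /t tpermK FK.
    have Kt : cancel (fun m => Fi (t m)) (fun p => t (F p)).
      by move=> m; rewrite FiK /t tpermK.
    have /= := uA _ _ tK Kt; rewrite /t tpermD // => /(_ Fk).
    by rewrite inE => /andP[_ /eqP].
  have : (\sum_m u 0 m *: (Fi m + Fi (t m)) = 0)%R.
    under eq_bigr => m _ do rewrite scalerDr.
    by rewrite big_split /= Fi_u Fi_tu addr0.
  rewrite (bigD1 i) //= (bigD1 j) 1?eq_sym //= big1 => [|m /andP[nmi nmj]].
    rewrite /t tpermL tpermR addr0 [(Fi j + Fi i)%R]addrC -scalerDl.
    move/eqP; rewrite scaler_eq0 addr_eq0_F2 (inj_eq (can_inj FiK)) (negPf nij).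
    rewrite orbF => /eqP Eij.
    by rewrite -[LHS]addr0 -(F2_addrr (u 0%R j)) addrA Eij add0r.
  by rewrite /t tpermD 1?eq_sym // addrr_F2 scaler0.
have [j] := @ord8_avoid [:: k] isT; rewrite inE => njk.
exists (u 0%R j); apply/rowP=> i; rewrite [RHS]mxE [const_mx _ _ _]mxE mxE eqxx /=.
have [-> /=|nik] := eqVneq i k; last by rewrite addr0 (const i j).
move: sum_u; rewrite (bigD1 k) //= (eq_bigr (fun=> u 0%R j)) => [|m nmk]; last first.
  exact: const.
(* u_k + 7 u_j = 1, hence u_k = u_j + 1 since 8 = 0 in F_2. *)
rewrite sumr_const cardC1 card_ord => <-.
rewrite addrCA -mulrS -mulr_natr (_ : 8%:R = 0)%R ?mulr0 ?addr0 //.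
exact/eqP.
Qed.

Lemma kernel_fixes_delta w k : w \in WD8 -> (forall x, omega_act x w = x) ->
  exists a : 'F_2, vact (delta_mx 0%R k) w = (const_mx a + delta_mx 0 k)%R.
Proof.
move=> Ww fix_w; apply: affine_of_all_basepoint => F Fi FK FiK Fk.
pose x : Omega240 := exist _ (fano_of F) (fano_of_labelled FK).
have lambdaE := lambda_affine FK FiK (erefl : val x = fano_of F).
rewrite -lambdaE -(fix_w x) lambda_omega_act // -vactV_coset ?WD8_signed //.
apply: imset_f; rewrite lambdaE inE; apply/andP; split; apply/eqP.
  rewrite (bigD1 k) //= big1 => [|j njk]; first by rewrite mxE !eqxx addr0.
  by rewrite mxE (negPf njk).
rewrite big1 // => j _; rewrite mxE eqxx /=.
by case: eqVneq => [->|_]; rewrite ?Fk ?scaler0 ?scale0r.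
Qed.

(** The translation part of w cancels in vact e_k w + vact e_l w, which
leaves e_(pi k) + e_(pi l) = e_k + e_l + const; the constant vanishes at a
coordinate outside the four labels involved. *)
Lemma fix_all_packings w : w \in WD8 -> (forall x, omega_act x w = x) ->
  w \in [set 1; w0].
Proof.
move=> Ww fix_w; have sw := WD8_signed Ww; have inj := sperm_obj_inj sw.
have pairs k l : k != l -> sperm_obj w k != k -> sperm_obj w l = k.
  move=> nkl nk.
  have [a Ek] := kernel_fixes_delta k Ww fix_w.
  have [b El] := kernel_fixes_delta l Ww fix_w.
  have sumE m : ((k == m)%:R + (l == m)%:R : 'F_2)%R =
      ((a + b) + ((k == sperm_obj w m)%:R + (l == sperm_obj w m)%:R))%R.
    have /(congr1 (fun v : 'rV['F_2]_8 => v 0%R (sperm_obj w m))) :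
        (vact (delta_mx 0 k) w + vact (delta_mx 0 l) w)%R =
        ((const_mx a + delta_mx 0 k) + (const_mx b + delta_mx 0 l))%R.
      by rewrite Ek El.
    rewrite mxE !vactE // !mxE !eqxx /= ![_ == m]eq_sym.
    rewrite ![_ == sperm_obj w m]eq_sym (addrACA a) [X in X = _ -> _]addrACA.
    by rewrite F2_addrr addr0 => ->.
  have [m] := @ord8_avoid [:: k; l; invF inj k; invF inj l] isT.
  rewrite !inE !negb_or => /and4P[nmk nml nmk' nml'].
  have wm i : m != invF inj i -> (i == sperm_obj w m) = false.
    move=> nmi; apply: contra_neqF nmi => /eqP->.
    by rewrite invF_f.
  have := sumE m; rewrite !wm // ![_ == m]eq_sym (negPf nmk) (negPf nml).
  rewrite !addr0 => ab0; have := sumE (invF inj k); rewrite -ab0 add0r f_invF.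
  rewrite eqxx [l == k]eq_sym (negPf nkl) addr0.
  have -> : (k == invF inj k) = false.
    by apply: contra_neqF nk => /eqP Ek'; rewrite {1}Ek' f_invF.
  rewrite add0r; case: (eqVneq l (invF inj k)) => [-> _|_ //].
  exact: f_invF.
(* If pi moves k, then pi sends every other label to k. *)
have obj_w k : sperm_obj w k = k.
  apply/eqP; apply: contraTT isT => nk.
  have [l] := @ord8_avoid [:: k] isT; rewrite inE => nlk.
  have [m] := @ord8_avoid [:: k; l] isT; rewrite !inE negb_or => /andP[nmk nml].
  have /inj Elm : sperm_obj w l = sperm_obj w m.
    by rewrite (pairs k l) ?(pairs k m) // eq_sym.
  by rewrite Elm eqxx in nml.
have [a E0] := kernel_fixes_delta ord0 Ww fix_w.
apply: (@signed_id_sgn_const w (a == 1)%R) => // k.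
have := congr1 (fun v : 'rV['F_2]_8 => v 0%R (sperm_obj w k)) E0.
rewrite vactE // obj_w !mxE [(a + _)%R]addrC => /addrI <-.
by case: sperm_sgn.
Qed.

Lemma kernel_WD8 : 'C_WD8([set: Omega240] | omega_action) = [set 1; w0].
Proof.
apply/eqP; rewrite eqEsubset; apply/andP; split; apply/subsetP=> w.
  case/setIP=> Ww /astab_act fix_w; apply: fix_all_packings => // x.
  by apply: fix_w; rewrite inE.
move=> w1; have Ww : w \in WD8.
  by case/set2P: w1 => ->; [exact: group1 | exact: w0_WD8].
do 2![apply/setIP; split=> //]; rewrite inE; apply/subsetP=> x _; rewrite inE.
by case/set2P: w1 => ->; rewrite ?act1 //= omega_act_w0.
Qed.

(** * Sgen generates W(D_8) *)

Lemma swapJ i j k : i != j -> j != k -> i != k -> swap i j ^ swap j k = swap i k.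
Proof.
move=> ij jk ik; rewrite {1}/swap conjMg !tpermJ !swapE // eqxx.
by rewrite (negPf ij) (negPf ik).
Qed.

Lemma swap_barJ i j k : i != j -> j != k -> i != k ->
  swap_bar i j ^ swap j k = swap_bar i k.
Proof.
move=> ij jk ik; rewrite {1}/swap_bar conjMg !tpermJ !swapE // eqxx.
by rewrite (negPf ij) (negPf ik).
Qed.

Lemma swapC i j : swap i j = swap j i.
Proof. by rewrite /swap tpermC [tperm (i, true) _]tpermC. Qed.

Lemma swap_barC i j : i != j -> swap_bar i j = swap_bar j i.
Proof.
move=> ij; have ji : j != i by rewrite eq_sym.
apply/permP=> -[k b]; rewrite !swap_barE //.
by have [->|] := eqVneq k i; first rewrite (negPf ij).
Qed.

(** By [swapJ], being equal or exchanged by a swap in <<Sgen>> is a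
transitive relation on labels, and adjacent labels are related. *)
Lemma swap_gen i j : i != j -> swap i j \in <<Sgen>>.
Proof.
pose linked (i j : 'I_8) := (i == j) || (swap i j \in <<Sgen>>).
have linked_trans a b c : linked a b -> linked b c -> linked a c.
  rewrite /linked; have [->//|ab /=] := eqVneq a b.
  have [<-|bc /=] := eqVneq b c; first by rewrite (negPf ab).
  have [//|ac /=] := eqVneq a c => Gab Gbc.
  by rewrite -(@swapJ a b c) // groupJ.
have linked0 n : (n < 8)%N -> linked ord0 (inord n).
  elim: n => [|n IHn] lt_n; first by apply/orP; left; rewrite -val_eqE /= inordK.
  apply: linked_trans (IHn (ltnW lt_n)) _; apply/orP; right.
  by apply/mem_gen/setU1P; right; apply/imsetP; exists (Ordinal (lt_n : n < 7)%N).
have linkedT k : linked ord0 k by rewrite -[k]inord_val linked0.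
move=> ij; have: linked i j.
  by apply: linked_trans (linkedT j); rewrite /linked eq_sym swapC; exact: linkedT.
by rewrite /linked (negPf ij).
Qed.

(** Conjugating the barred generator by swaps moves its two labels one at a
time. *)
Lemma swap_bar_gen i j : i != j -> swap_bar i j \in <<Sgen>>.
Proof.
have step a b c : a != b -> a != c -> swap_bar a b \in <<Sgen>> ->
    swap_bar a c \in <<Sgen>>.
  move=> ab ac Gab; have [<-//|bc] := eqVneq b c.
  by rewrite -(@swap_barJ a b c) // groupJ ?swap_gen.
have G12 : swap_bar (obj 1) (obj 2) \in <<Sgen>> by apply/mem_gen/setU11.
have n12 : obj 1 != obj 2 by rewrite -val_eqE /= !inordK.
move=> ij; have [Ei|ni] := eqVneq (obj 1) i.
  by rewrite -Ei in ij *; apply: step G12.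
rewrite swap_barC //.
have [Ej|nj] := eqVneq (obj 1) j; first by rewrite -Ej; apply: step G12.
rewrite eq_sym in ij; rewrite eq_sym in nj.
apply: (step _ (obj 1)) => //; rewrite swap_barC //.
by apply: step G12; rewrite // eq_sym.
Qed.

(** Induction on the number of objects that w does not fix with their sign.
If w moves the label k to l, a swap of k and l, barred if w changes the sign
of k, brings k home. If w only changes signs, then it changes at least two of
them, those of k and l say, and swap k l * swap_bar k l changes them back. *)
Lemma gen_Sgen : <<Sgen>> = WD8.
Proof.
apply/eqP; rewrite eqEsubset gen_subG Sgen_sub_WD8 /=; apply/subsetP=> w.
pose moved u := [set k | u (k, false) != (k, false) :> sobj].
have [n] := ubnP #|moved w|; elim: n w => // n IHn w lt_n Ww.
have sw := WD8_signed Ww.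
(* The induction step, for an element u that undoes the effect of w on k
   without disturbing what w already fixes. *)
have reduce u k : u \in <<Sgen>> -> k \in moved w ->
    u (w (k, false)) = (k, false) ->
    (forall j, j \notin moved w -> u (j, false) = (j, false)) ->
    w \in <<Sgen>>.
  move=> Gu wk uk fix_u; rewrite -(groupMr _ Gu); apply: IHn; last first.
    by rewrite groupM //; apply: subsetP Gu; rewrite gen_subG Sgen_sub_WD8.
  rewrite -ltnS; apply: leq_trans lt_n; rewrite ltnS; apply/proper_card/properP.
  split; last by exists k; rewrite // inE permM uk eqxx.
  apply/subsetP=> j; apply: contraLR => wj; rewrite inE negbK permM.
  by move: (wj); rewrite inE negbK => /eqP->; rewrite fix_u.
have [k nk | obj_w] := pickP (fun k => sperm_obj w k != k).
  pose l := sperm_obj w k; have kl : k != l by rewrite eq_sym.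
  pose u := if sperm_sgn w k then swap_bar k l else swap k l.
  apply: (reduce u k).
  - by rewrite /u; case: ifP; rewrite ?swap_gen ?swap_bar_gen.
  - by rewrite inE signed_permE // xpair_eqE (negPf nk).
  - rewrite signed_permE // /u -/l.
    by case: ifP; rewrite ?swapE ?swap_barE // eqxx eq_sym (negPf kl).
  move=> j; rewrite inE negbK signed_permE // => /eqP[wj _].
  have jk : j != k by apply: contraNneq nk => <-; rewrite wj.
  have jl : j != l by rewrite -wj (inj_eq (sperm_obj_inj sw)).
  by rewrite /u; case: ifP; rewrite ?swapE ?swap_barE // (negPf jk) (negPf jl).
have {}obj_w k : sperm_obj w k = k by have /negbFE/eqP := obj_w k.
have [k sk | sgn_w] := pickP (sperm_sgn w); last first.
  have /set2P[] := signed_id_sgn_const sw obj_w sgn_w => Ew.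
    by rewrite Ew group1.
  by have := sgn_w ord0; rewrite Ew /sperm_sgn permE.
have [l /andP[lk sl] | sgn_w] := pickP (fun l => (l != k) && sperm_sgn w l).
  have kl : k != l by rewrite eq_sym.
  apply: (reduce (swap k l * swap_bar k l) k).
  - by rewrite groupM ?swap_gen ?swap_bar_gen.
  - by rewrite inE signed_permE // xpair_eqE sk andbF.
  - rewrite signed_permE // obj_w sk permM swapE // eqxx swap_barE //.
    by rewrite (negPf lk) eqxx.
  move=> j; rewrite inE negbK signed_permE // => /eqP[_ sj].
  have jk : j != k by apply: contraTneq sk => <-; rewrite sj.
  have jl : j != l by apply: contraTneq sl => <-; rewrite sj.
  by rewrite permM swapE // (negPf jk) (negPf jl) swap_barE // (negPf jk) (negPf jl).
(* A single sign change contradicts evenness. *)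
have := WD8_sum Ww; rewrite (bigD1 k) //= sk big1 => [|j jk].
  by rewrite addr0 => /eqP; rewrite oner_eq0.
by have := sgn_w j; rewrite jk /= => ->.
Qed.

(** * Proper parabolic subgroups do not contain w0 *)

Lemma val_obj n : (n < 8)%N -> val (obj n.+1) = n.
Proof. exact: inordK. Qed.

Lemma Sgen_adjacent (i : 'I_7) : swap (obj i.+1) (obj i.+2) \in Sgen.
Proof. by apply/setU1P; right; apply: imset_f. Qed.

Lemma swap_adjacentE (i : 'I_7) (k : 'I_8) b :
  let p := swap (obj i.+1) (obj i.+2) (k, b) in
  p.2 = b /\
  p.1 = (if k == i :> nat then i.+1
         else if k == i.+1 :> nat then i : nat else k) :> nat.
Proof.
have v1 : val (obj i.+1) = i by rewrite val_obj // ltnW // ltnS.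
have v2 : val (obj i.+2) = i.+1 by rewrite val_obj // ltnS.
rewrite swapE -!val_eqE /= v1 v2; last by rewrite neq_ltn ltnSn.
by case: ifP => _; last case: ifP => _.
Qed.

Lemma swap_bar12E (k : 'I_8) b :
  swap_bar (obj 1) (obj 2) (k, b) =
  (if k == 0%N :> nat then obj 2 else if k == 1%N :> nat then obj 1 else k,
   if (k < 2)%N then ~~ b else b).
Proof.
rewrite swap_barE -!val_eqE /= !val_obj //.
by case: k => [[|[|k]] ltk].
Qed.

(** X is the set of the signed objects on which the fundamental weight of s
is positive. The weights are (1, ..., 1) for the barred generator,
(-1, 1, ..., 1) for (1, 2), and (0, ..., 0, 1, ..., 1), with i + 1 leading
zeros, for the swap of the objects i + 1 and i + 2 when i > 0 (up to scaling
and sign). All of them have a positive last coordinate, so that X tells object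
8 from its opposite. *)
Lemma weight_stable s : s \in Sgen -> exists X : {set sobj},
  [/\ (ord_max, false) \in X, (ord_max, true) \notin X &
      forall t p, t \in Sgen -> t != s -> p \in X -> t p \in X].
Proof.
case/setU1P=> [-> | /imsetP[i _ ->]].
  exists [set p : sobj | ~~ p.2]; split=> [||t [k b]]; rewrite ?inE //= => /orP[/eqP->|].
    by rewrite eqxx.
  by case/imsetP=> j _ -> _; case: (swap_adjacentE j k b) => /= ->.
have [i0 | i_gt0] := posnP i.
  exists [set p : sobj | p.2 == (p.1 == 0%N :> nat)].
  split=> [||t [k b] Gt]; rewrite ?inE //= => nt /eqP->.
  case/setU1P: Gt nt => [-> _|/imsetP[j _ ->] nt].
    rewrite swap_bar12E /=.
    by case: k => [[|[|k]] ltk]; rewrite /= ?val_obj.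
  have j_gt0 : (0 < j)%N.
    rewrite lt0n; apply: contraNneq nt => j0.
    by rewrite j0 i0.
  case: (swap_adjacentE j k (k == 0%N :> nat)) => /= -> ->.
  apply/eqP; case: (@eqP _ (k : nat) j) => [-> | _]; first by rewrite gtn_eqF.
  by case: (@eqP _ (k : nat) j.+1) => [-> | //]; rewrite [RHS]gtn_eqF.
exists [set p : sobj | (i < p.1)%N && ~~ p.2].
split=> [||t [k b] Gt]; rewrite ?inE ?andbF ?andbT //= => nt /andP[lt_ik nb].
case/setU1P: Gt nt => [-> _|/imsetP[j _ ->] nt].
  have k_gt1 : (1 < k)%N := leq_ltn_trans i_gt0 lt_ik.
  rewrite swap_bar12E /= (ltnNge k 2) k_gt1 /= nb andbT.
  by rewrite gtn_eqF ?gtn_eqF // ltnW.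
case: (swap_adjacentE j k b) => /= -> ->.
rewrite nb andbT; case: eqP => [<- | _]; first exact: ltnW.
case: eqP => [Ek | //]; move: lt_ik; rewrite Ek ltnS leq_eqVlt => /orP[/eqP Eij|//].
by rewrite Eij eqxx in nt.
Qed.

(** The subgroup <<J>> stabilises the set X of [weight_stable], while w0
exchanges the two signed versions of object 8, only one of which is in X. *)
Lemma w0_notin_gen (J : {set {perm sobj}}) s :
  J \subset Sgen -> s \in Sgen -> s \notin J -> w0 \notin <<J>>.
Proof.
move=> sJ Ss nJs; have [X [Xp Xn stX]] := weight_stable Ss.
have sJX : <<J>> \subset 'N(X | 'P).
  rewrite gen_subG; apply/subsetP=> t Jt; rewrite !inE /=.
  apply/subsetP=> p Xpp; rewrite inE /= apermE.
  apply: stX => //; first exact: subsetP Jt.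
  by apply: contraNneq nJs => <-.
apply: contra Xn => /(subsetP sJX) Nw0.
have := astabs_act (ord_max, false) Nw0.
by rewrite Xp /= apermE permE.
Qed.

(** Missing one generator is enough to be proper, as w0 is in W(D_8). *)
Lemma proper_parabolic_gen (J : {set {perm sobj}}) s :
  J \subset Sgen -> s \in Sgen -> s \notin J -> proper_parabolic <<J>>%G.
Proof.
move=> sJ Ss nJs; split; first by exists J.
move/(congr1 val) => /= EJ.
by have := w0_notin_gen sJ Ss nJs; rewrite EJ w0_WD8.
Qed.

(** Here [gen_Sgen] is what makes a parabolic subgroup other than W(D_8) miss
a generator. *)
Lemma w0_notin_proper P : proper_parabolic P -> w0 \notin P.
Proof.
case=> [[J sJ ->] /eqP nJ] /=.
have /subsetPn[s Ss nJs] : ~~ (Sgen \subset J).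
  apply: contra nJ => SJ; apply/eqP/val_inj => /=.
  have -> : J = Sgen by apply/eqP; rewrite eqEsubset sJ.
  exact: gen_Sgen.
exact: w0_notin_gen nJs.
Qed.

(** * Faithfulness on proper parabolic subgroups *)

Lemma proper_parabolic_faithful (P : {group {perm sobj}}) : proper_parabolic P ->
  [faithful P, on [set: Omega240] | omega_action].
Proof.
move=> pP; have nPw0 := w0_notin_proper pP.
have sPW : P \subset WD8.
  by case: pP => [[J sJ ->] _]; rewrite gen_subG (subset_trans sJ Sgen_sub_WD8).
apply/subsetP=> w /setIP[Pw Cw].
have: w \in [set 1; w0] by rewrite -kernel_WD8 inE (subsetP sPW).
by case/set2P=> Ew; rewrite Ew ?inE // -Ew Pw in nPw0 *.
Qed.

Theorem theorem5p6 :
  [/\ 'C_WD8([set: Omega240] | omega_action) = 'Z(WD8),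
      'Z(WD8) = [set 1; w0],
      forall P : {group {perm sobj}}, proper_parabolic P ->
        [faithful P, on [set: Omega240] | omega_action],
      [/\ proper_parabolic par_S8, proper_parabolic par_WD7,
          proper_parabolic par_WD6 & proper_parabolic par_WD5]
    & [/\ [faithful par_S8, on [set: Omega240] | omega_action],
          [faithful par_WD7, on [set: Omega240] | omega_action],
          [faithful par_WD6, on [set: Omega240] | omega_action]
        & [faithful par_WD5, on [set: Omega240] | omega_action]]].
Proof.
have S78 : swap (obj 7) (obj 8) \in Sgen := Sgen_adjacent ord_max.
have proper4 : [/\ proper_parabolic par_S8, proper_parabolic par_WD7,
    proper_parabolic par_WD6 & proper_parabolic par_WD5].
  split.
  - apply: (@proper_parabolic_gen _ (swap_bar (obj 1) (obj 2))).
    + exact: subsetDl.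
    + exact: setU11.
    + by rewrite !inE eqxx.
  - by apply: proper_parabolic_gen S78 _; rewrite ?subsetDl // !inE eqxx.
  - by apply: proper_parabolic_gen S78 _; rewrite ?subsetDl // !inE eqxx ?orbT.
  - by apply: proper_parabolic_gen S78 _; rewrite ?subsetDl // !inE eqxx ?orbT.
split; [by rewrite kernel_WD8 center_WD8 | exact: center_WD8 | | exact: proper4 |].
  exact: proper_parabolic_faithful.
by case: proper4 => *; split; apply: proper_parabolic_faithful.
Qed.
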